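(* Let $S$ be an integral domain, $\sigma\in\mathrm{Aut}(S)$ of finite order $m$, $S_0=\{s\in S:\sigma(s)=s\}$, $f(t)\in S[t;\sigma]$ a monic polynomial of degree $n$, and $b\in S^\times$. Suppose $G:\mathbb{S}_f\to\mathbb{S}_{t^n-b}$ is a nonzero ring homomorphism satisfying $G|_S=\tau$ for some $\tau\in\mathrm{Aut}(S)$ commuting with $\sigma$, such that $G(t)$ is not a monomial. Let $k=\deg(G(t))$. Suppose further that, if $s>1$ is the least value for which $sk\ge n$, then $(s+1)k\le 2n$. Then $\mathbb{S}_{t^n-b}$ must be associative, that is, $b\in S_0$ and $m\mid n$.
   Context: $S[t;\sigma]$ is the skew polynomial ring with $tc=\sigma(c)t$ for $c\in S$. For a monic $f\in S[t;\sigma]$ of degree $n$, every $g\in S[t;\sigma]$ can be written uniquely as $g=qf+r$ with $\deg r<n$; write $r=g \bmod_r f$. The Petit ring $\mathbb{S}_f$ is the additive group of skew polynomials of degree $<n$ with multiplication $g\circ h=gh \bmod_r f$; it is a unital, in general nonassociative, ring containing $S$ as the constants. ''Not a monomial'' means $G(t)$ is not of the form $ct^i$ with $c\in S$, i.e. it has at least two nonzero coefficients; $\deg(G(t))$ is the degree of the representative of degree $<n$. *)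

(* Defs.v *)
From HB Require Import structures.
From mathcomp Require Import all_boot all_order all_algebra.
From mathcomp Require Import zify.
Set Implicit Arguments.
Unset Strict Implicit.
Unset Printing Implicit Defensive.
Import GRing.Theory.
Local Open Scope ring_scope.

Section IterMorphism.
Variables (S : nzRingType) (sigma : {rmorphism S -> S}) (i : nat).

Lemma iter_rmorph0 : iter i sigma 0 = 0.
Proof. by elim: i => //= j ->; rewrite rmorph0. Qed.

Lemma iter_rmorph1 : iter i sigma 1 = 1.
Proof. by elim: i => //= j ->; rewrite rmorph1. Qed.

Lemma iter_rmorphD x y : iter i sigma (x + y) = iter i sigma x + iter i sigma y.
Proof. by elim: i => //= j ->; rewrite rmorphD. Qed.

Lemma iter_rmorphM x y : iter i sigma (x * y) = iter i sigma x * iter i sigma y.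
Proof. by elim: i => //= j ->; rewrite rmorphM. Qed.

Lemma iter_rmorph_sum I (r : seq I) (P : pred I) (F : I -> S) :
  iter i sigma (\sum_(j <- r | P j) F j) =
    \sum_(j <- r | P j) iter i sigma (F j).
Proof. exact: (big_morph _ iter_rmorphD iter_rmorph0). Qed.

End IterMorphism.

(* S[t; sigma]: the additive group (and size, lead_coef, monic) is that of
   {poly S}, with coefficients written on the left of the powers of t; only
   the product differs, being determined by t c = sigma(c) t. *)
Definition skewpoly (S : nzRingType) (sigma : {rmorphism S -> S}) : Type :=
  {poly S}.

Section SkewPoly.
Variables (S : nzRingType) (sigma : {rmorphism S -> S}).
Local Notation skewpoly := (skewpoly sigma).
Local Notation sg i := (iter i sigma).

HB.instance Definition _ := GRing.Zmodule.on skewpoly.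

Definition skewC (c : S) : skewpoly := c%:P.
Definition skewX : skewpoly := 'X.

(* (a t^i) (b t^j) = a sigma^i(b) t^(i+j) *)
Definition skew_mul (p q : skewpoly) : skewpoly :=
  \poly_(k < (size p + size q).-1)
    \sum_(i < k.+1) p`_i * sg i q`_(k - i).

Lemma coef_skew_mul p q k :
  (skew_mul p q)`_k = \sum_(i < k.+1) p`_i * sg i q`_(k - i).
Proof.
rewrite coef_poly; case: ltnP => // le_pq_k.
rewrite big1 // => i _; have [lt_i_p | le_p_i] := ltnP i (size p); last first.
  by rewrite nth_default ?mul0r.
have le_q : (size q <= k - i)%N by lia.
by rewrite [q`__]nth_default ?iter_rmorph0 ?mulr0.
Qed.

Lemma coef_skew_mul_rev p q k :
  (skew_mul p q)`_k = \sum_(i < k.+1) p`_(k - i) * sg (k - i)%N q`_i.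
Proof.
rewrite coef_skew_mul (reindex_inj rev_ord_inj) /=.
by apply: eq_bigr => i _; rewrite subSS subKn // -ltnS.
Qed.

Fact skew_mulA : associative skew_mul.
Proof.
move=> p q r; apply/polyP=> i; rewrite coef_skew_mul coef_skew_mul_rev.
pose coef3 j k := p`_j * (sg j q`_(i - j - k)%N * sg (i - k)%N r`_k).
transitivity (\sum_(j < i.+1) \sum_(k < i.+1 | (k <= i - j)%N) coef3 j k).
  apply: eq_bigr => /= j _; rewrite coef_skew_mul_rev iter_rmorph_sum big_distrr.
  rewrite (big_ord_narrow_leq (leq_subr _ _)) /=; apply: eq_bigr => k _.
  rewrite /coef3 iter_rmorphM -iterD; congr (_ * (_ * iter _ _ _)).
  by have := ltn_ord j; have := ltn_ord k; lia.
rewrite (exchange_big_dep predT) //=; apply: eq_bigr => k _.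
transitivity (\sum_(j < i.+1 | (j <= i - k)%N) coef3 j k).
  apply: eq_bigl => j; rewrite -ltnS -(ltnS j) -!subSn ?leq_ord //.
  by rewrite -subn_gt0 -(subn_gt0 j) -!subnDA addnC.
rewrite (big_ord_narrow_leq (leq_subr _ _)) coef_skew_mul big_distrl /=.
by apply: eq_bigr => j _; rewrite /coef3 -!subnDA addnC mulrA.
Qed.

Fact skew_mul1p : left_id (skewC 1) skew_mul.
Proof.
move=> p; apply/polyP=> i; rewrite coef_skew_mul big_ord_recl subn0 coefC /=.
by rewrite mul1r big1 ?addr0 // => j _; rewrite coefC mul0r.
Qed.

Fact skew_mulp1 : right_id (skewC 1) skew_mul.
Proof.
move=> p; apply/polyP=> i; rewrite coef_skew_mul_rev big_ord_recl subn0 coefC /=.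
rewrite iter_rmorph1 mulr1 big1 ?addr0 // => j _.
by rewrite coefC iter_rmorph0 mulr0.
Qed.

Fact skew_mulDl : left_distributive skew_mul +%R.
Proof.
move=> p q r; apply/polyP=> i; rewrite coefD !coef_skew_mul -big_split.
by apply: eq_bigr => j _; rewrite coefD mulrDl.
Qed.

Fact skew_mulDr : right_distributive skew_mul +%R.
Proof.
move=> p q r; apply/polyP=> i; rewrite coefD !coef_skew_mul -big_split.
by apply: eq_bigr => j _; rewrite coefD iter_rmorphD mulrDr.
Qed.

Fact skewC1_neq0 : skewC 1 != 0.
Proof. by rewrite polyC_eq0 oner_neq0. Qed.

HB.instance Definition _ := GRing.Zmodule_isNzRing.Build skewpoly
  skew_mulA skew_mul1p skew_mulp1 skew_mulDl skew_mulDr skewC1_neq0.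

Lemma coef_skewM (p q : skewpoly) k :
  (p * q)`_k = \sum_(i < k.+1) p`_i * sg i q`_(k - i).
Proof. exact: coef_skew_mul. Qed.

Lemma coef_skewCM c (p : skewpoly) k : (skewC c * p)`_k = c * p`_k.
Proof.
rewrite coef_skewM big_ord_recl subn0 coefC /= big1 ?addr0 // => i _.
by rewrite coefC mul0r.
Qed.

Lemma coef_skewXM (p : skewpoly) k :
  (skewX * p)`_k = if k == 0%N then 0 else sigma p`_k.-1.
Proof.
rewrite coef_skewM; case: k => [|k]; first by rewrite big_ord1 coefX mul0r.
rewrite !big_ord_recl big1 ?addr0; last by move=> i _; rewrite coefX mul0r.
by rewrite !coefX /= mul0r add0r mul1r subSS subn0.
Qed.

Lemma skewX_exp i : skewX ^+ i = 'X^i :> {poly S}.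
Proof.
elim: i => [|i IHi]; first by rewrite !expr0.
apply/polyP => -[|k]; rewrite exprS coef_skewXM ?coefXn //=.
by rewrite IHi !coefXn eqSS; case: eqP => _; rewrite ?rmorph1 ?rmorph0.
Qed.

Lemma skewX_comm c : skewX * skewC c = skewC (sigma c) * skewX.
Proof.
apply/polyP => -[|[|k]]; rewrite coef_skewXM coef_skewCM coefX coefC /=.
- by rewrite mulr0.
- by rewrite mulr1.
- by rewrite mulr0 rmorph0.
Qed.

Lemma skewpoly_sumE (p : skewpoly) :
  p = \sum_(i < size p) skewC p`_i * skewX ^+ i.
Proof.
rewrite -[LHS]coefK poly_def; apply: eq_bigr => i _; apply/polyP => k.
by rewrite coef_skewCM skewX_exp coefZ.
Qed.

Lemma skewXnsubC_monic n b :
  (0 < n)%N -> (skewX ^+ n - skewC b : skewpoly) \is monic.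
Proof. by move=> n_gt0; rewrite skewX_exp; exact: monicXnsubC. Qed.

Lemma size_skewXnsubC n b :
  (0 < n)%N -> size (skewX ^+ n - skewC b : skewpoly) = n.+1.
Proof. by move=> n_gt0; rewrite skewX_exp; exact: size_XnsubC. Qed.

(* Degree of a nonzero skew polynomial (and 0 for the zero polynomial). *)
Definition skewdeg (p : skewpoly) : nat := (size p).-1.

Fixpoint skew_divmod_rec (f : skewpoly) (fuel : nat) (q g : skewpoly) :
    skewpoly * skewpoly :=
  if (size g < size f)%N then (q, g) else
  if fuel is fuel'.+1 then
    let u := skewC (lead_coef g) * skewX ^+ (size g - size f) in
    skew_divmod_rec f fuel' (q + u) (g - u * f)
  else (q, g).

(* g = skew_quo g f * f + skew_mod g f, for monic f: see skew_divP and
   skew_div_unique below. *)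
Definition skew_quo (g f : skewpoly) := (skew_divmod_rec f (size g) 0 g).1.
Definition skew_mod (g f : skewpoly) := (skew_divmod_rec f (size g) 0 g).2.

Lemma coef_skewXnM d (p : skewpoly) k :
  (skewX ^+ d * p)`_k = if (k < d)%N then 0 else sg d p`_(k - d).
Proof.
elim: d k => [|d IHd] k; first by rewrite expr0 mul1r subn0.
rewrite exprS -mulrA coef_skewXM; case: k => [|k] //=.
by rewrite IHd ltnS subSS; case: ifP => // _; rewrite rmorph0.
Qed.

Lemma skew_div_step (f g : skewpoly) : f \is monic -> (size f <= size g)%N ->
  (size (g - skewC (lead_coef g) * skewX ^+ (size g - size f) * f)%R
     < size g)%N.
Proof.
move=> fmon le_fg; have f_gt0 : (0 < size f)%N.
  by rewrite size_poly_gt0 monic_neq0.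
rewrite -[X in (_ < X)%N]prednK ?ltnS; last exact: leq_trans le_fg.
apply/leq_sizeP => k le_k; rewrite coefB -mulrA coef_skewCM coef_skewXnM.
rewrite ifF; last by apply/negbTE; move: le_k f_gt0 le_fg; clear; lia.
have [gt_k | ->] : (size g <= k)%N \/ k = (size g).-1.
- by lia.
- have ge_f : (size f <= k - (size g - size f))%N by lia.
  by rewrite [g`_k]nth_default // [f`__]nth_default ?iter_rmorph0 ?mulr0 ?subr0.
- have -> : ((size g).-1 - (size g - size f))%N = (size f).-1.
    by move: f_gt0 le_fg; clear; lia.
  by rewrite -!lead_coefE (monicP fmon) iter_rmorph1 mulr1 subrr.
Qed.

Lemma skew_divP (f g : skewpoly) : f \is monic ->
  g = skew_quo g f * f + skew_mod g f /\ (size (skew_mod g f) < size f)%N.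
Proof.
move=> fmon; rewrite /skew_quo /skew_mod.
have recP : forall fuel (q h : skewpoly), (size h <= fuel)%N ->
    let qr := skew_divmod_rec f fuel q h in
    q * f + h = qr.1 * f + qr.2 /\ (size qr.2 < size f)%N.
  elim=> [|fuel IH] q h /= le_h; case: ltnP => //= le_fh.
    have := leq_trans le_fh le_h; rewrite leqn0 size_poly_eq0.
    by rewrite (negbTE (monic_neq0 fmon)).
  have lt_h := skew_div_step fmon le_fh.
  have [|<- ?] := IH (q + skewC (lead_coef h) * skewX ^+ (size h - size f))
    (h - skewC (lead_coef h) * skewX ^+ (size h - size f) * f) _.
    by rewrite -ltnS (leq_trans lt_h).
  by split=> //; rewrite mulrDl addrACA subrr addr0.
by have [] := recP (size g) 0 g (leqnn _); rewrite mul0r add0r.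
Qed.

Lemma lead_skewM_monic (f h : skewpoly) : f \is monic ->
  (h * f)`_((size h).-1 + (size f).-1) = lead_coef h.
Proof.
move=> fmon; rewrite coef_skewM; set a := (size h).-1; set n := (size f).-1.
have lt_a : (a < (a + n).+1)%N by rewrite ltnS leq_addr.
rewrite (bigD1 (Ordinal lt_a)) //= addKn big1 ?addr0 => [|i ne_ia].
  by rewrite -!lead_coefE (monicP fmon) iter_rmorph1 mulr1.
have {}ne_ia : (i : nat) <> a by move=> e; case/eqP: ne_ia; apply: val_inj.
have [lt_ai | lt_ia] : (a < i)%N \/ (i < a)%N by lia.
  have le_h : (size h <= i)%N by lia.
  by rewrite [h`_i]nth_default ?mul0r.
have le_f : (size f <= a + n - i)%N by lia.
by rewrite [f`__]nth_default ?iter_rmorph0 ?mulr0.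
Qed.

Lemma skew_div_unique (f q r : skewpoly) : f \is monic ->
  (size r < size f)%N ->
  skew_quo (q * f + r) f = q /\ skew_mod (q * f + r) f = r.
Proof.
move=> fmon lt_r; have [] := skew_divP (q * f + r) fmon.
set q' := skew_quo _ _; set r' := skew_mod _ _ => e lt_r'.
have eh : (q' - q) * f = r - r'.
  by apply/eqP; rewrite mulrBl subr_eq addrAC eq_sym subr_eq addrC e.
have h0 : q' - q = 0.
  apply/eqP; rewrite -[_ == 0]lead_coef_eq0 -(lead_skewM_monic _ fmon) eh.
  have le_rr : (size (r - r')%R <= (size f).-1)%N.
    have le_r : (size r <= (size f).-1)%N by lia.
    have le_r' : (size r' <= (size f).-1)%N by lia.
    by rewrite (leq_trans (size_polyD _ _)) // size_polyN geq_max le_r.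
  by rewrite nth_default // (leq_trans le_rr) ?leq_addl.
split; first by apply/eqP; rewrite -subr_eq0 h0.
by apply/esym/eqP; rewrite -subr_eq0 -eh h0 mul0r.
Qed.

Lemma skew_mod_small (f g : skewpoly) : f \is monic ->
  (size g < size f)%N -> skew_mod g f = g.
Proof.
by move=> fmon lt_g; have [_] := skew_div_unique 0 fmon lt_g; rewrite mul0r add0r.
Qed.

Lemma skew_modD (f g h : skewpoly) : f \is monic ->
  skew_mod (g + h) f = skew_mod g f + skew_mod h f.
Proof.
move=> fmon; have [eg lt_g] := skew_divP g fmon.
have [eh lt_h] := skew_divP h fmon.
rewrite {1}eg {1}eh addrACA -mulrDl.
have lt_gh : (size (skew_mod g f + skew_mod h f)%R < size f)%N.
  by rewrite (leq_ltn_trans (size_polyD _ _)) // gtn_max lt_g.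
by have [_ ->] := skew_div_unique (skew_quo g f + skew_quo h f) fmon lt_gh.
Qed.

End SkewPoly.

Section Petit.
Variables (S : nzRingType) (sigma : {rmorphism S -> S}).
Variables (f : skewpoly sigma) (fmon : f \is monic).

Definition petit_pred : pred (skewpoly sigma) :=
  fun p => (size p < size f)%N.

(* The Petit ring S_f.  It is in general nonassociative, hence not one of the
   library's rings: it is a zmodType with a separate product petit_mul. *)
Record petit (mon : f \is monic) : Type := Petit {
  petit_val : skewpoly sigma;
  petit_valP : petit_pred petit_val
}.

HB.instance Definition _ := [isSub of petit fmon for @petit_val fmon].
HB.instance Definition _ := [Choice of petit fmon by <:].

Fact petit_zmod_closed : zmod_closed petit_pred.
Proof.
split=> [|p q]; rewrite !unfold_in /petit_pred; last move=> lt_p lt_q.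
  by rewrite size_poly0 size_poly_gt0 monic_neq0.
by rewrite (leq_ltn_trans (size_polyD _ _)) // size_polyN gtn_max lt_p.
Qed.

HB.instance Definition _ :=
  GRing.SubChoice_isSubZmodule.Build _ _ (petit fmon) petit_zmod_closed.

Definition petit_of (g : skewpoly sigma) : petit fmon :=
  Petit fmon (skew_divP g fmon).2.

Definition petit_mul (x y : petit fmon) : petit fmon :=
  petit_of (petit_val x * petit_val y).

(* t and the constants as elements of S_f; when n <= 1, t has to be reduced. *)
Definition petitX : petit fmon := petit_of (skewX sigma).
Definition petitC (c : S) : petit fmon := petit_of (skewC sigma c).

Lemma petit_valK : cancel (@petit_val fmon) petit_of.
Proof. by case=> p lt_p; apply: val_inj; apply: skew_mod_small. Qed.

Lemma petit_ofK (g : skewpoly sigma) : (size g < size f)%N -> petit_val (petit_of g) = g.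
Proof. exact: skew_mod_small. Qed.

Lemma petit_ofD g h : petit_of (g + h) = petit_of g + petit_of h.
Proof. by apply: val_inj; apply: skew_modD. Qed.

Lemma petit_mulDl : left_distributive petit_mul +%R.
Proof. by move=> x y z; rewrite /petit_mul -petit_ofD -mulrDl. Qed.

Lemma petit_mulDr : right_distributive petit_mul +%R.
Proof. by move=> x y z; rewrite /petit_mul -petit_ofD -mulrDr. Qed.

Lemma petitC_val c : (1 < size f)%N -> petit_val (petitC c) = skewC sigma c.
Proof.
by move=> gt1; apply: petit_ofK; rewrite (leq_ltn_trans (size_polyC_leq1 c)).
Qed.

Lemma petitX_val : (2 < size f)%N -> petit_val petitX = skewX sigma.
Proof. by move=> gt2; apply: petit_ofK; rewrite size_polyX. Qed.

Lemma petit_mul1 : (1 < size f)%N ->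
  left_id (petitC 1) petit_mul /\ right_id (petitC 1) petit_mul.
Proof.
have C1 : skewC sigma 1 = 1 by [].
move=> gt1; split=> x; rewrite /petit_mul petitC_val // C1 ?mul1r ?mulr1.
  exact: petit_valK.
exact: petit_valK.
Qed.

End Petit.

Definition is_monomial (S : nzRingType) (sigma : {rmorphism S -> S})
    (p : skewpoly sigma) : Prop :=
  exists (c : S) (i : nat), p = skewC sigma c * skewX sigma ^+ i.

Definition petit_hom (S : nzRingType) (sigma : {rmorphism S -> S})
    (f g : skewpoly sigma) (fmon : f \is monic) (gmon : g \is monic)
    (G : petit fmon -> petit gmon) : Prop :=
  {morph G : x y / x + y} /\ {morph G : x y / petit_mul x y}.

Definition aut_order (S : nzRingType) (sigma : {rmorphism S -> S})
    (m : nat) : Prop :=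
  [/\ (0 < m)%N, iter m sigma =1 id &
      forall j, (0 < j < m)%N -> ~ iter j sigma =1 id].

Definition fixed_ring (S : nzRingType) (sigma : {rmorphism S -> S}) :
    {pred S} := [pred c | sigma c == c].

(* s is the least integer > 1 with s k >= n *)
Definition least_multiple (n k s : nat) : Prop :=
  [/\ (1 < s)%N, (n <= s * k)%N &
      forall s', (1 < s')%N -> (n <= s' * k)%N -> (s <= s')%N].

(* Main.v *)
(** Write [g = G(t)] and [F = t^n - b].  Commutation of [t] with constants gives
    [g c = sigma(c) g], so if [sigma <> id] then [g] has no constant term, and,
    not being a monomial, it has degree [k >= 2]; hence [s + 1 <= n].  Divide
    the skew power [g^s = Q F + x]: then [x = G(t^s)], with [Q] of degree
    [s k - n < n].  From [x c = sigma^s(c) x] and [g^s c = sigma^s(c) g^s],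
    comparing the coefficients of index [s k - n] and [s k] yields
    [sigma^n = id].  Now [g o x = G(t^(s+1)) = x o g], whereas [g] commutes with
    [g^s]; thus [Q F g], and then [Q (sigma(b) - b) g], vanishes modulo [F].  The
    latter has degree [(s+1) k - n <= n] and no constant term, so it is zero
    already in [S[t; sigma]], which forces [sigma(b) = b]. *)

Require Import Defs.
From mathcomp Require Import all_boot all_order all_algebra.
From mathcomp Require Import zify.
Set Implicit Arguments.
Unset Strict Implicit.
Unset Printing Implicit Defensive.
Import GRing.Theory.
Local Open Scope ring_scope.

(** * Divisibility by the order of [sigma] *)

Section IterOrder.
Variables (S : nzRingType) (sigma : {rmorphism S -> S}) (m : nat).
Hypothesis sigma_order : aut_order sigma m.

(** If the [n]-th iterate is the identity, so is the one of index [n %% m], and minimality of [m]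
    forces this remainder to be zero. *)
Lemma iter_aut_order n : (m %| n)%N <-> iter n sigma =1 id.
Proof.
have [m_gt0 sm hmin] := sigma_order.
have iterMm q c : iter (q * m) sigma c = c.
  by elim: q => //= q IHq; rewrite mulSn iterD IHq sm.
split=> [/dvdnP[q ->] c // | sn].
apply/eqP; case: (posnP (n %% m)) => // r_gt0.
case: (hmin (n %% m)%N) => [|c]; first by rewrite r_gt0 ltn_mod.
by rewrite -[RHS]sn {2}(divn_eq n m) addnC iterD iterMm.
Qed.

End IterOrder.

(** * Coefficients of skew products and reduction modulo a monic polynomial *)

Section SkewCoef.
Variables (S : nzRingType) (sigma : {rmorphism S -> S}).
Implicit Types p q r : skewpoly sigma.
Local Notation sg i := (iter i sigma).

(** Every other term of the sum has a factor beyond one of the size bounds. Since [a] and [c] only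
    bound the degrees, the coefficient may vanish. *)
Lemma coef_skewM_top p q a c : (size p <= a.+1)%N -> (size q <= c.+1)%N ->
  (p * q)`_(a + c) = p`_a * sg a q`_c.
Proof.
move=> le_p le_q; rewrite coef_skewM.
have lt_a : (a < (a + c).+1)%N by rewrite ltnS leq_addr.
rewrite (bigD1 (Ordinal lt_a)) //= addKn big1 ?addr0 // => i ne_ia.
have {}ne_ia : (i : nat) <> a by move=> e; case/eqP: ne_ia; apply: val_inj.
have [lt_ai | lt_ia] : (a < i)%N \/ (i < a)%N by lia.
  by rewrite [p`_i]nth_default ?mul0r // (leq_trans le_p).
have lt_c : (c.+1 <= a + c - i)%N by lia.
by rewrite [q`__]nth_default ?iter_rmorph0 ?mulr0 // (leq_trans le_q).
Qed.

Lemma size_skewM_leq p q : (size (p * q)%R <= (size p + size q).-1)%N.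
Proof. exact: size_poly. Qed.

Lemma coef_skewMC p c j : (p * skewC sigma c)`_j = p`_j * sg j c.
Proof.
rewrite coef_skewM big_ord_recr /= subnn coefC eqxx big1 ?add0r // => i _.
by rewrite coefC subn_eq0 leqNgt ltn_ord /= iter_rmorph0 mulr0.
Qed.

Lemma size_skewMC p c : (size (p * skewC sigma c)%R <= size p)%N.
Proof.
apply/leq_sizeP => j le_j.
by rewrite coef_skewMC nth_default // mul0r.
Qed.

Lemma size_skewCM c p : (size (skewC sigma c * p)%R <= size p)%N.
Proof.
apply/leq_sizeP => j le_j.
by rewrite coef_skewCM nth_default // mulr0.
Qed.

Lemma coef_skewMXn p d j :
  (p * skewX sigma ^+ d)`_j = if (j < d)%N then 0 else p`_(j - d).
Proof.
rewrite coef_skewM skewX_exp; case: ltnP => [lt_jd | le_dj].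
  rewrite big1 // => i _; rewrite coefXn ltn_eqF ?iter_rmorph0 ?mulr0 //.
  exact: leq_ltn_trans (leq_subr _ _) lt_jd.
have lt_i : (j - d < j.+1)%N by rewrite ltnS leq_subr.
rewrite (bigD1 (Ordinal lt_i)) //= subKn // coefXn eqxx iter_rmorph1 mulr1.
rewrite big1 ?addr0 // => i ne_i; rewrite coefXn.
case: eqP => [e|_]; last by rewrite iter_rmorph0 mulr0.
case/eqP: ne_i; apply: val_inj => /=.
by have := ltn_ord i; move: e le_dj; clear; lia.
Qed.

Lemma skewXn_comm i c :
  skewX sigma ^+ i * skewC sigma c = skewC sigma (sg i c) * skewX sigma ^+ i.
Proof.
elim: i => [|i IHi]; first by rewrite expr0 mul1r mulr1.
by rewrite {1}exprS -mulrA IHi mulrA skewX_comm -mulrA -exprS.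
Qed.

Lemma skew_exp_comm p i :
  (forall c, p * skewC sigma c = skewC sigma (sigma c) * p) ->
  forall c, p ^+ i * skewC sigma c = skewC sigma (sg i c) * p ^+ i.
Proof.
move=> pC; elim: i => [|i IHi] c; first by rewrite expr0 mul1r mulr1.
by rewrite exprS -mulrA IHi !mulrA pC.
Qed.

Lemma coef_skewMXnsubC p n b j :
  (p * (skewX sigma ^+ n - skewC sigma b))`_j =
    (if (j < n)%N then 0 else p`_(j - n)) - p`_j * sg j b.
Proof. by rewrite mulrBr coefB coef_skewMXn coef_skewMC. Qed.

Lemma skew_modMl (F : skewpoly sigma) (Fmon : F \is monic) q r :
  skew_mod (q * F + r) F = skew_mod r F.
Proof.
rewrite skew_modD // -[q * F]addr0.
have lt0 : (size (0%R : skewpoly sigma) < size F)%N.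
  by rewrite size_poly0 size_poly_gt0 monic_neq0.
by have [_ ->] := skew_div_unique q Fmon lt0; rewrite add0r.
Qed.

(** Both bracketings reduce to the product of the three representatives modulo [F]. Reduction kills
    left multiples of [F] only, so a quotient term multiplied on the right by [r] vanishes because
    [F] can be moved past [r]. *)
Lemma petit_mulA_central (F : skewpoly sigma) (Fmon : F \is monic) :
  (forall p, F * p = p * F) -> associative (@petit_mul S sigma F Fmon).
Proof.
move=> Fcent x y z; apply: val_inj => /=.
set p := petit_val x; set q := petit_val y; set r := petit_val z.
have [eqr _] := skew_divP (q * r) Fmon; have [epq _] := skew_divP (p * q) Fmon.
transitivity (skew_mod (p * q * r) F).
  by rewrite -mulrA {2}eqr mulrDr mulrA skew_modMl.
by rewrite {1}epq mulrDl -mulrA Fcent mulrA skew_modMl.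
Qed.

Lemma XnsubC_central n b : iter n sigma =1 id -> sigma b = b ->
  (forall c : S, b * c = c * b) ->
  forall p, (skewX sigma ^+ n - skewC sigma b) * p =
            p * (skewX sigma ^+ n - skewC sigma b).
Proof.
move=> sn sb bC p; apply/polyP => j.
have sjb : sg j b = b by elim: j => //= j ->.
rewrite coef_skewMXnsubC mulrBl coefB coef_skewXnM coef_skewCM sjb bC.
by case: ifP => // _; rewrite sn.
Qed.

End SkewCoef.

(** * Nonvanishing of coefficients over an integral domain *)

Section SkewDomain.
Variables (S : idomainType) (sigma : {rmorphism S -> S}).
Hypothesis sigma_inj : injective sigma.
Implicit Types p q r : skewpoly sigma.
Local Notation sg i := (iter i sigma).

Lemma iter_rmorph_inj i : injective (sg i).
Proof. by elim: i => //= i IHi x y /sigma_inj/IHi. Qed.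

Lemma iter_rmorph_eq0 i c : (sg i c == 0) = (c == 0).
Proof. by rewrite -[RHS](inj_eq (@iter_rmorph_inj i)) iter_rmorph0. Qed.

Lemma skew_exp_top p k i : (size p <= k.+1)%N -> p`_k != 0 ->
  (size (p ^+ i)%R <= (i * k).+1)%N /\ (p ^+ i)`_(i * k) != 0.
Proof.
move=> le_p pk; elim: i => [|i [le_pi pi]].
  rewrite expr0 size_poly1 coefC /=; split=> //; exact: oner_neq0.
rewrite exprS mulSn; split.
  by rewrite (leq_trans (size_skewM_leq _ _)) //; move: le_p le_pi; clear; lia.
by rewrite coef_skewM_top // mulf_neq0 // iter_rmorph_eq0.
Qed.

(** The coefficients of index [j] give [p_j sigma^j(c) = sigma^i(c) p_j], and [p_j] cancels in a
    domain. *)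
Lemma skew_comm_coef p i j : (forall c, p * skewC sigma c = skewC sigma (sg i c) * p) ->
  p`_j != 0 -> sg j =1 sg i.
Proof.
move=> pC pj c; have := congr1 (fun q : skewpoly sigma => q`_j) (pC c).
by rewrite /= coef_skewMC coef_skewCM mulrC => /(mulIf pj).
Qed.

(** Here [p = q F] with [q] constant by degree, and the constant coefficient of [q F] is [- q_0 b].
    The size bound admits degree [n], one more than a remainder may have; the vanishing constant
    term covers this case. *)
Lemma skew_mod_XnsubC_eq0 p n (b : S) (n_gt0 : (0 < n)%N) : b != 0 ->
  (size p <= n.+1)%N -> p`_0 = 0 ->
  skew_mod p (skewX sigma ^+ n - skewC sigma b) = 0 -> p = 0.
Proof.
set F := skewX sigma ^+ n - _ => b0 le_p p0 modp0.
have Fmon : F \is monic by exact: skewXnsubC_monic.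
have sF : size F = n.+1 by exact: size_skewXnsubC.
have [] := skew_divP p Fmon; rewrite modp0 addr0.
set q := skew_quo p F => ep _.
have le_q : (size q <= 1)%N.
  rewrite leqNgt; apply/negP => q_gt1.
  have := lead_skewM_monic q Fmon; rewrite -ep sF nth_default.
    by move/esym/eqP; rewrite lead_coef_eq0 -size_poly_eq0; case: (size q) q_gt1.
  by rewrite (leq_trans le_p) //= -add1n leq_add2r -ltnS (ltn_predK q_gt1).
have := p0; rewrite ep coef_skewMXnsubC n_gt0 /= sub0r => /eqP.
rewrite oppr_eq0 mulf_eq0 (negPf b0) orbF => /eqP q0.
by rewrite (size1_polyC le_q) q0 polyC0 mul0r.
Qed.

End SkewDomain.

(** * Images of the powers of [t] under a homomorphism *)

Section PetitHom.
Variables (S : nzRingType) (sigma : {rmorphism S -> S}).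
Variables (f F : skewpoly sigma) (fmon : f \is monic) (Fmon : F \is monic).
Variables (G : petit fmon -> petit Fmon) (G_hom : petit_hom G).
Variables (tau : {rmorphism S -> S}) (tau_bij : bijective tau).
Hypothesis tau_sigma : forall c, tau (sigma c) = sigma (tau c).
Hypothesis G_tau : forall c, G (petitC fmon c) = petitC _ (tau c).
Hypothesis eq_size : size F = size f.
Local Notation sg i := (iter i sigma).
Local Notation X := (skewX sigma).
Local Notation Gt i := (petit_val (G (petit_of fmon (X ^+ i)))).

Let size_X i : size (X ^+ i) = i.+1.
Proof. by rewrite skewX_exp size_polyXn. Qed.

Lemma petit_hom_X : petit_val (G (petitX fmon)) = Gt 1.
Proof. by rewrite expr1. Qed.

(** The bounds make [t^i] and [t^j] their own representatives; their product is the class of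
    [t^(i+j)], with no bound on [i + j]. *)
Lemma petit_hom_XnM i j : (i.+1 < size f)%N -> (j.+1 < size f)%N ->
  Gt (i + j) = skew_mod (Gt i * Gt j) F.
Proof.
move=> lt_i lt_j; have [_ GM] := G_hom.
rewrite -[RHS]/(petit_val (petit_mul _ _)) -GM /petit_mul.
by rewrite !petit_ofK ?size_X // -exprD.
Qed.

(** Apply [G] to [t^i c = sigma^i(c) t^i]. Surjectivity of [tau] reaches every constant, and
    multiplying by a constant never requires reduction. *)
Lemma petit_hom_XnC i : (i.+1 < size f)%N ->
  forall c, Gt i * skewC sigma c = skewC sigma (sg i c) * Gt i.
Proof.
move=> lt_i d; have [tau' tauK tau'K] := tau_bij; rewrite -(tau'K d).
move: (tau' d) => c {d}; have [_ GM] := G_hom.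
have gt1 : (1 < size f)%N by rewrite (leq_trans _ lt_i).
have tau_sg j : tau (sg j c) = sg j (tau c) by elim: j => //= j <-.
have e : petit_mul (petit_of fmon (X ^+ i)) (petitC fmon c) =
    petit_mul (petitC fmon (sg i c)) (petit_of fmon (X ^+ i)).
  by rewrite /petit_mul !petitC_val // petit_ofK ?size_X // skewXn_comm.
have := congr1 (fun y => petit_val (G y)) e.
rewrite /= !GM !G_tau tau_sg /petit_mul !petitC_val ?eq_size //.
have lt_x := petit_valP (G (petit_of fmon (X ^+ i))).
by rewrite !petit_ofK //; apply: leq_ltn_trans lt_x;
  [exact: size_skewCM | exact: size_skewMC].
Qed.

(** As long as [i k] is less than the degree of [F], no power up to the [i]-th needs reduction, so
    Petit powers are skew powers. *)
Lemma petit_hom_Xn_exp i k : (size (Gt 1) <= k.+1)%N ->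
  (0 < i)%N -> (i.+1 < size f)%N -> (i * k + 1 < size f)%N ->
  Gt i = Gt 1 ^+ i.
Proof.
move=> le_g; case: i => // i _; elim: i => [|i IHi] lt_i lt_ik.
  by rewrite expr1.
have e : Gt i.+1 = Gt 1 ^+ i.+1 by apply: IHi; move: lt_i lt_ik; clear; lia.
rewrite -[i.+2]/(1 + i.+1)%N petit_hom_XnM; try by move: lt_i; clear; lia.
rewrite e -exprS skew_mod_small // eq_size (leq_ltn_trans _ lt_ik) //.
have size_exp j : (size (Gt 1 ^+ j)%R <= (j * k).+1)%N.
  elim: j => [|j IHj]; first by rewrite expr0 size_poly1.
  rewrite exprS (leq_trans (size_skewM_leq _ _)) //.
  by move: IHj le_g; clear; lia.
by rewrite addn1.
Qed.

End PetitHom.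

(** * The least multiple and the comparison of degrees modulo [t^n - b] *)

Lemma least_multiple_exists n k : (0 < k)%N -> exists s, least_multiple n k s.
Proof.
move=> k_gt0; have ex_s : exists s, (1 < s)%N && (n <= s * k)%N.
  by exists n.+2; rewrite /= (leq_trans _ (leq_pmulr _ k_gt0)) // -addn2 leq_addr.
case: (ex_minnP ex_s) => s /andP[s_gt1 le_n] smin; exists s; split=> // s' ? ?.
by apply: smin; apply/andP.
Qed.

Theorem theorem6p3 (S : idomainType) (sigma : {rmorphism S -> S})
    (sigma_bij : bijective sigma) (m : nat) (sigma_order : aut_order sigma m)
    (n : nat) (n_gt0 : (0 < n)%N)
    (f : skewpoly sigma) (fmon : f \is monic) (deg_f : skewdeg f = n)
    (b : S) (b_unit : b \is a GRing.unit)
    (G : petit fmon -> petit (skewXnsubC_monic sigma b n_gt0))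
    (G_hom : petit_hom G) (G_neq0 : exists x, G x <> 0)
    (tau : {rmorphism S -> S}) (tau_bij : bijective tau)
    (tau_sigma : forall c, tau (sigma c) = sigma (tau c))
    (G_tau : forall c, G (petitC fmon c) = petitC _ (tau c))
    (Gt_nmon : ~ is_monomial (petit_val (G (petitX fmon))))
    (k : nat) (deg_Gt : skewdeg (petit_val (G (petitX fmon))) = k)
    (hs : forall s, least_multiple n k s -> (s.+1 * k <= 2 * n)%N) :
  associative (@petit_mul S sigma _ (skewXnsubC_monic sigma b n_gt0)) /\
  (b \in fixed_ring sigma /\ (m %| n)%N).
Proof.
suff [sb sn] : sigma b = b /\ iter n sigma =1 id.
  split; last by split; [apply/eqP | apply/(iter_aut_order sigma_order)].
  by apply: petit_mulA_central; apply: XnsubC_central => // c; exact: mulrC.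
have sigma_inj := bij_inj sigma_bij.
have [m_gt0 sm hmin] := sigma_order.
(* For [sigma = id] both claims are immediate; from here on [sigma] differs from its zeroth
   iterate. *)
have [m1 | m_ne1] := eqVneq m 1%N.
  move: sm; rewrite m1 => sm; split; first exact: sm.
  by apply/(iter_aut_order sigma_order); rewrite m1 dvd1n.
have sigma_neq1 : ~ iter 1 sigma =1 id by apply: hmin; lia.
set F := skewX sigma ^+ n - skewC sigma b.
have Fmon : F \is monic by exact: skewXnsubC_monic.
have sF : size F = n.+1 by exact: size_skewXnsubC.
have sf : size f = n.+1 by rewrite -deg_f /skewdeg prednK // size_poly_gt0 monic_neq0.
have sFf : size F = size f by rewrite sF sf.
have GXnC := petit_hom_XnC G_hom tau_bij tau_sigma G_tau sFf.
have GXnM := petit_hom_XnM G_hom.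
have GXn_exp := petit_hom_Xn_exp G_hom sFf.
rewrite petit_hom_X in Gt_nmon deg_Gt.
pose x i : skewpoly sigma := petit_val (G (petit_of fmon (skewX sigma ^+ i))).
pose g := x 1%N; rewrite -/(x 1%N) -/g in Gt_nmon deg_Gt.
have lt_g : (size g < n.+1)%N by rewrite -sF; exact: petit_valP.
have g_neq0 : g != 0.
  apply/eqP => g0; apply: Gt_nmon; exists 0, 0%N.
  by rewrite g0 /skewC polyC0 mul0r.
have gk : g`_k != 0 by rewrite -deg_Gt -lead_coefE lead_coef_eq0.
have size_g : size g = k.+1.
  by rewrite -deg_Gt /skewdeg prednK // size_poly_gt0.
have k_gt0 : (0 < k)%N.
  rewrite lt0n; apply/eqP => k0; apply: Gt_nmon; exists g`_0, 0%N.
  by rewrite expr0 mulr1; apply: size1_polyC; rewrite size_g k0.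
have gC : forall c, g * skewC sigma c = skewC sigma (sigma c) * g.
  by move=> c; rewrite (GXnC 1%N) // sf; move: size_g lt_g k_gt0; clear; lia.
(* A nonzero constant coefficient would equate the iterates of [sigma] of index 0 and 1. *)
have g0 : g`_0 = 0.
  apply/eqP; apply/negPn/negP => g0; apply: sigma_neq1 => c.
  by rewrite -(skew_comm_coef (i := 1) gC g0).
have k_gt1 : (1 < k)%N.
  rewrite ltn_neqAle k_gt0 andbT eq_sym; apply/eqP => k1; apply: Gt_nmon.
  exists g`_1, 1%N; apply/polyP => -[|[|j]]; rewrite coef_skewCM expr1 coefX.
  - by rewrite g0 mulr0.
  - by rewrite mulr1.
  - by rewrite mulr0 nth_default // size_g k1.
have lt_kn : (k < n)%N by rewrite -ltnS -size_g.
have [s hsP] := least_multiple_exists n k_gt0.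
have le_sk := hs s hsP; have [s_gt1 le_n smin] := hsP.
(* Minimality only ranges over integers above 1, so [s = 2] is settled separately by [k < n]. *)
have lt_s1 : (s.-1 * k < n)%N.
  case: (ltngtP 2 s) => [s_gt2||<-]; last 2 first.
  - by rewrite ltnNge s_gt1.
  - by rewrite mul1n.
  rewrite ltnNge; apply/negP => /(smin s.-1 _) le_s.
  by move: le_s s_gt2; clear; lia.
have lt_sn : (s < n)%N by move: k_gt1 lt_s1 lt_kn; clear; nia.
have xs1 : x s.-1 = g ^+ s.-1.
  by apply: (GXn_exp _ k); rewrite ?size_g ?sf //; move: s_gt1 lt_sn lt_s1; clear; lia.
have xs : x s = skew_mod (g ^+ s) F.
  rewrite -(prednK (ltnW s_gt1)) exprS -xs1 -add1n.
  by apply: GXnM; rewrite sf; move: s_gt1 lt_sn; clear; lia.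
(* Both sides are [G(t^(s+1))]. Only [s < n] is required: [t^(s+1)] itself may need reduction modulo
   [f]. *)
have comm_xs : skew_mod (g * x s) F = skew_mod (x s * g) F.
  have [lt1 lts] : (2 < size f)%N /\ (s.+1 < size f)%N.
    by rewrite sf; move: s_gt1 lt_sn; clear; lia.
  by rewrite /g -!GXnM // addnC.
have [] := skew_divP (g ^+ s) Fmon; rewrite -xs.
set Q := skew_quo _ _ => gsE; rewrite sF ltnS => size_xs.
have [size_gs gs_top] := skew_exp_top sigma_inj s (eq_leq size_g) gk.
set d := (s * k - n)%N.
have dn : (d + n = s * k)%N by rewrite subnK.
have lt_dn : (d < n)%N.
  by move: le_sk k_gt0 dn; rewrite mulSn; clear; lia.
(* Otherwise the leading coefficient of [Q] would sit in [g^s - x s] at an index beyond the degrees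
   of both terms. *)
have size_Q : (size Q <= d.+1)%N.
  rewrite leqNgt; apply/negP => lt_Q.
  have := lead_skewM_monic Q Fmon.
  rewrite (_ : Q * F = g ^+ s - x s); last by rewrite gsE addrK.
  rewrite sF /= coefB !nth_default ?subrr.
  - by move/esym/eqP; rewrite lead_coef_eq0 -size_poly_eq0; case: (size Q) lt_Q.
  - by rewrite (leq_trans size_xs) // leq_addl.
  - by rewrite (leq_trans size_gs) // -dn -addSn leq_add2r -ltnS (ltn_predK lt_Q).
have Qd : Q`_d = (g ^+ s)`_(s * k).
  rewrite gsE coefD coef_skewMXnsubC -dn ltnNge leq_addl /= addnK.
  rewrite [Q`_(d + n)]nth_default ?mul0r ?subr0; last first.
    by rewrite (leq_trans size_Q) // -addn1 leq_add2l.
  by rewrite [(x s)`__]nth_default ?addr0 // (leq_trans size_xs) // leq_addl.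
have Qd_neq0 : Q`_d != 0 by rewrite Qd.
have b_neq0 : b != 0 by apply: contraTneq b_unit => ->; rewrite unitr0.
have gsC := skew_exp_comm s gC.
have xsC : forall c, x s * skewC sigma c = skewC sigma (iter s sigma c) * x s.
  by apply: GXnC; rewrite sf.
(* As [d < n], the coefficient of index [d] of [g^s] is that of [x s] minus [Q_d sigma^d(b)], which
   is nonzero. So [g^s] or [x s] has a nonzero coefficient there, and either one yields the
   claim. *)
have sds : iter d sigma =1 iter s sigma.
  have [gsd0 | ] := eqVneq (g ^+ s)`_d 0; last exact: skew_comm_coef gsC.
  apply: (skew_comm_coef xsC); move: gsd0.
  rewrite gsE coefD coef_skewMXnsubC lt_dn sub0r => /eqP.
  rewrite addrC subr_eq0 => /eqP->.
  by rewrite mulf_neq0 // iter_rmorph_eq0.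
(* The top coefficient of [g^s], of index [d + n], gives [sigma^(d+n) = sigma^s = sigma^d];
   injectivity cancels [sigma^d]. *)
have sn : iter n sigma =1 id.
  move=> c; apply: (@iter_rmorph_inj _ _ sigma_inj d).
  by rewrite -iterD dn (skew_comm_coef gsC gs_top) sds.
split=> //.
pose delta := sigma b - b.
pose p : skewpoly sigma := Q * skewC sigma delta * g.
(* Now [t^n] commutes with [g], so the defect comes from [b] alone, through [g b = sigma(b) g]. *)
have Fg : F * g = g * F + skewC sigma delta * g.
  have Xng : skewX sigma ^+ n * g = g * skewX sigma ^+ n.
    by apply/polyP => j; rewrite coef_skewXnM coef_skewMXn sn.
  rewrite /F mulrBl mulrBr Xng gC /delta.
  have -> : skewC sigma (sigma b - b) = skewC sigma (sigma b) - skewC sigma b.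
    exact: polyCB.
  by rewrite mulrBl addrA subrK.
have modp : skew_mod p F = 0.
  (* This is [g g^s = g^s g] with [g^s = Q F + x s] inserted on both sides. Modulo [F] only [p]
     survives. *)
  have e : g * x s + (g * Q) * F = x s * g + (Q * g * F + p).
    rewrite /p -[Q * _ * g]mulrA -[Q * g * F]mulrA -mulrDr -Fg mulrA -mulrDl.
    by rewrite addrC -mulrA -mulrDr [x s + _]addrC -gsE -exprS -exprSr.
  have := congr1 (fun y : skewpoly sigma => skew_mod y F) e.
  rewrite /= addrC skew_modMl // addrCA skew_modMl // skew_modD // comm_xs.
  by move/eqP; rewrite eq_sym -subr_eq0 addrAC subrr add0r => /eqP.
have size_Qd : (size (Q * skewC sigma delta)%R <= d.+1)%N.
  exact: leq_trans (size_skewMC _ _) size_Q.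
(* The hypothesis [(s+1) k <= 2 n] says exactly that [d + k <= n], which bounds the degree of
   [p]. *)
have p0 : p = 0.
  apply: skew_mod_XnsubC_eq0 modp => //.
    rewrite (leq_trans (size_skewM_leq _ _)) // size_g.
    by move: size_Qd le_sk dn; rewrite mulSn; clear; lia.
  by rewrite coef_skewM big_ord1 g0 iter_rmorph0 mulr0.
(* This coefficient is [Q_d sigma^d(delta) sigma^d(g_k)], whose only factor that can vanish is the
   middle one. *)
have := congr1 (fun q : skewpoly sigma => q`_(d + k)) p0.
rewrite /= coef_skewM_top ?size_g // coef_skewMC coef0 => /eqP.
rewrite !mulf_eq0 !iter_rmorph_eq0 // (negPf gk) (negPf Qd_neq0) orbF /=.
by rewrite subr_eq0 => /eqP.
Qed.
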